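(* Let $X$ be an honest metric space. If $X$ is an ultrametric space, i.e. $X(a,c)\le\max(X(a,b),X(b,c))$ for all $a,b,c\in X$, then its persistent homology is trivial at all scales in all dimensions $\ge1$; that is, $$H_n\overline{N}_{\max}(X)(r)=0$$ for all $r\in\mathbb{R}^{\mathrm{op}}$ and all $n\ge1$.
   Context: $\mathbb{R}^{\mathrm{op}}$ is the poset of extended nonnegative reals $0\le r\le\infty$ with the usual order. An honest metric space is a set $X$ with distances $X(a,b)\in[0,\infty]$ satisfying $X(a,b)=0$ iff $a=b$, symmetry, and the triangle inequality $X(a,c)\le X(a,b)+X(b,c)$ (a metric space in the classical sense). $N_{\max}(X)(r)$ is the simplicial set whose $n$-simplices are the tuples $(x_0,\dots,x_n)$ of points of $X$ for which there exist $r_1,\dots,r_n\in[0,\infty]$ with $\max_kr_k\le r$ and $X(x_i,x_j)\le\max_{i+1\le k\le j}r_k$ for all $0\le i\le j\le n$ (empty $\max$ is $0$); equivalently, tuples with $X(x_i,x_j)\le r$ for all $0\le i\le j\le n$. Faces omit and degeneracies repeat vertices. $\overline{N}_{\max}(X)(r)$ is the simplicial abelian group obtained by applying the free abelian group functor, and $H_n$ is the homology of its normalized Moore complex, i.e. the homology of the simplicial set $N_{\max}(X)(r)$. Persistent homology of $X$ is $r\mapsto H_\bullet\overline{N}_{\max}(X)(r)$. *)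

(* Defs.v *)
From HB Require Import structures.
From mathcomp Require Import freeg.
From mathcomp Require Import all_boot all_order all_algebra.
From mathcomp Require Import boolp reals constructive_ereal.

Set Implicit Arguments.
Unset Strict Implicit.
Unset Printing Implicit Defensive.

Import Order.TTheory GRing.Theory Num.Theory.
Local Open Scope ring_scope.

(* The morphisms [m] -> [n] of the simplex category, [n] = {0, ..., n} being
   represented by 'I_n.+1. *)
Record simplex_map (m n : nat) := SimplexMap {
  smap_fun :> 'I_m.+1 -> 'I_n.+1;
  smap_homo : {homo smap_fun : i j / (i <= j)%N}
}.

Lemma smap_eq m n (f g : simplex_map m n) : f =1 g -> f = g.
Proof.
case: f g => [f fh] [g gh] /= /funext fg; subst g.
by congr SimplexMap; exact: Prop_irrelevance.
Qed.

Definition smap_id n : simplex_map n n :=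
  @SimplexMap n n id (fun i j le_ij => le_ij).

Definition smap_comp m n p (g : simplex_map n p) (f : simplex_map m n) :
  simplex_map m p :=
  @SimplexMap m p (g \o f) (fun i j le_ij => smap_homo g (smap_homo f le_ij)).

Lemma coface_homo n (i : 'I_n.+2) : {homo lift i : j k / (j <= k)%N}.
Proof. by move=> j k le_jk; rewrite leq_bump2. Qed.

Definition coface n (i : 'I_n.+2) : simplex_map n n.+1 :=
  SimplexMap (@coface_homo n i).

Lemma coface0K n (i : 'I_n.+2) :
  smap_comp (coface (lift ord0 i)) (coface ord0) =
  smap_comp (coface ord0) (coface i).
Proof.
apply: smap_eq => j /=; apply: val_inj; rewrite /= /bump /=.
by rewrite !add1n ltnS addnS.
Qed.

Record simplicial_set := SimplicialSet {
  sset_obj :> nat -> Type;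
  sset_act : forall m n, simplex_map m n -> sset_obj n -> sset_obj m;
  sset_id : forall n x, sset_act (smap_id n) x = x;
  sset_comp : forall m n p (g : simplex_map n p) (f : simplex_map m n) x,
    sset_act (smap_comp g f) x = sset_act f (sset_act g x)
}.

Record simplicial_abgroup := SimplicialAbGroup {
  sab_obj :> nat -> zmodType;
  sab_act : forall m n, simplex_map m n -> {additive sab_obj n -> sab_obj m};
  sab_id : forall n x, sab_act (smap_id n) x = x;
  sab_comp : forall m n p (g : simplex_map n p) (f : simplex_map m n) x,
    sab_act (smap_comp g f) x = sab_act f (sab_act g x)
}.

Section FreeAbGroup.
Variables (K L : choiceType) (f : K -> L).

Definition fgmap : {freeg K} -> {freeg L} :=
  fglift (fun k => << f k >> : {freeg L}).

Lemma fgmap_is_additive : additive fgmap.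
Proof. exact: lift_is_additive. Qed.

HB.instance Definition _ :=
  GRing.isAdditive.Build {freeg K} {freeg L} fgmap fgmap_is_additive.

Lemma fgmapU k x : fgmap << k *g x >> = << k *g f x >>.
Proof.
by rewrite /fgmap liftU; apply/eqP/freeg_eqP => y; rewrite coeffZ !coeffU mul1r.
Qed.

End FreeAbGroup.

Lemma fgmap_id (K : choiceType) (D : {freeg K}) : fgmap id D = D.
Proof.
rewrite -{1}[D]freeg_sumE raddf_sum -[RHS]freeg_sumE.
by apply: eq_bigr => k _; exact: fgmapU.
Qed.

Lemma fgmap_comp (K L M : choiceType) (g : L -> M) (f : K -> L) (D : {freeg K}) :
  fgmap (g \o f) D = fgmap g (fgmap f D).
Proof.
rewrite -[D]freeg_sumE !raddf_sum; apply: eq_bigr => k _.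
by rewrite /= !fgmapU.
Qed.

Section FreeSimplicialAbGroup.
Variable X : simplicial_set.

Definition free_obj n : zmodType := {freeg {classic X n}}.

Definition free_act m n (f : simplex_map m n) : {additive free_obj n -> free_obj m} :=
  fgmap (sset_act f : {classic X n} -> {classic X m}).

Lemma free_id n x : free_act (smap_id n) x = x.
Proof.
rewrite /free_act /=.
have -> : sset_act (smap_id n) = id :> (X n -> X n).
  by apply: funext => y; exact: sset_id.
exact: fgmap_id.
Qed.

Lemma free_comp m n p (g : simplex_map n p) (f : simplex_map m n) x :
  free_act (smap_comp g f) x = free_act f (free_act g x).
Proof.
rewrite /free_act /=.
have -> : sset_act (smap_comp g f) = sset_act f \o sset_act g :> (X p -> X m).
  by apply: funext => y; exact: sset_comp.
exact: fgmap_comp.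
Qed.

Definition free_simplicial_abgroup : simplicial_abgroup :=
  @SimplicialAbGroup free_obj free_act free_id free_comp.

End FreeSimplicialAbGroup.

Record chain_complex := ChainComplex {
  chain :> nat -> zmodType;
  chain_diff : forall n, {additive chain n.+1 -> chain n};
  chain_diffK : forall n x, chain_diff n (chain_diff n.+1 x) = 0
}.

Section Homology.
Variables (C : chain_complex) (n : nat).

Definition is_cycle : {pred C n} :=
  match n return {pred C n} with
  | 0 => fun=> true
  | m.+1 => fun x => chain_diff C m x == 0
  end.

Lemma is_cycle_closed : zmod_closed is_cycle.
Proof.
rewrite /is_cycle; case: n => [|m]; split=> //.
  by rewrite unfold_in raddf0.
move=> x y; rewrite !unfold_in => /eqP x0 /eqP y0.
by rewrite raddfB x0 y0 subrr.
Qed.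
HB.instance Definition _ := GRing.isZmodClosed.Build (C n) is_cycle is_cycle_closed.

Definition cycles : Type := {x : C n | x \in is_cycle}.
HB.instance Definition _ := SubChoice.on cycles.
HB.instance Definition _ := [SubChoice_isSubZmodule of cycles by <:].

Definition is_boundary : {pred cycles} :=
  fun z => `[< exists y : C n.+1, chain_diff C n y = val z >].

Lemma is_boundary_closed : zmod_closed is_boundary.
Proof.
split; first by apply/asboolP; exists 0; rewrite !raddf0.
move=> x y /asboolP[u ux] /asboolP[v vy].
by apply/asboolP; exists (u - v); rewrite !raddfB ux vy.
Qed.
HB.instance Definition _ :=
  GRing.isZmodClosed.Build cycles is_boundary is_boundary_closed.

Definition homology : zmodType := Quotient.quot is_boundary.

End Homology.

Section Moore.
Variable A : simplicial_abgroup.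

Definition face n (i : 'I_n.+2) : {additive A n.+1 -> A n} := sab_act A (coface i).

(* Convention: NA_n is the intersection of the kernels of d_1, ..., d_n, and the
   differential is d_0. *)
Definition is_moore n : {pred A n} :=
  match n return {pred A n} with
  | 0 => fun=> true
  | m.+1 => fun x => [forall i : 'I_m.+1, face (lift ord0 i) x == 0]
  end.

Lemma is_moore_closed n : zmod_closed (@is_moore n).
Proof.
rewrite /is_moore; case: n => [|m]; split=> //.
  by rewrite unfold_in; apply/forallP => i; rewrite raddf0.
move=> x y; rewrite !unfold_in => /forallP x0 /forallP y0.
by apply/forallP => i; rewrite raddfB (eqP (x0 i)) (eqP (y0 i)) subrr.
Qed.
HB.instance Definition _ n :=
  GRing.isZmodClosed.Build (A n) (@is_moore n) (@is_moore_closed n).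

Definition moore_obj n : Type := {x : A n | x \in @is_moore n}.
HB.instance Definition _ n := SubChoice.on (moore_obj n).
HB.instance Definition _ n := [SubChoice_isSubZmodule of moore_obj n by <:].

Lemma face0_comm n (i : 'I_n.+2) (x : A n.+2) :
  face i (face ord0 x) = face ord0 (face (lift ord0 i) x).
Proof. by rewrite /face -!sab_comp coface0K. Qed.

Lemma face0_moore n (x : moore_obj n.+1) : face ord0 (val x) \in @is_moore n.
Proof.
case: n x => [|n] [x /= /forallP x0] //.
by apply/forallP => i; rewrite face0_comm (eqP (x0 _)) raddf0.
Qed.

Definition moore_diff_fun n (x : moore_obj n.+1) : moore_obj n :=
  exist _ (face ord0 (val x)) (face0_moore x).

Lemma moore_diff_is_additive n : additive (@moore_diff_fun n).
Proof. by move=> x y; apply: val_inj; rewrite /= !raddfB. Qed.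
HB.instance Definition _ n :=
  GRing.isAdditive.Build (moore_obj n.+1) (moore_obj n) (@moore_diff_fun n)
    (@moore_diff_is_additive n).

Definition moore_diff n : {additive moore_obj n.+1 -> moore_obj n} :=
  @moore_diff_fun n.

Lemma moore_diffK n x : moore_diff n (moore_diff n.+1 x) = 0.
Proof.
apply: val_inj; case: x => [x /= /forallP x0].
by rewrite face0_comm (eqP (x0 _)) raddf0.
Qed.

Definition moore_complex : chain_complex :=
  @ChainComplex (fun n => moore_obj n : zmodType) moore_diff moore_diffK.

End Moore.

Local Open Scope ereal_scope.

(* Distances may be infinite. *)
Record honest_metric_space (R : realType) := HonestMetricSpace {
  metric_point :> Type;
  dist : metric_point -> metric_point -> \bar R;
  dist_ge0 : forall a b, 0 <= dist a b;
  dist_eq0 : forall a b, dist a b = 0 <-> a = b;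
  dist_sym : forall a b, dist a b = dist b a;
  dist_triangle : forall a b c, dist a c <= dist a b + dist b c
}.

Definition ultrametric (R : realType) (X : honest_metric_space R) : Prop :=
  forall a b c : X, dist a c <= maxe (dist a b) (dist b c).

Section Nmax.
Variables (R : realType) (X : honest_metric_space R) (r : \bar R).

(* The lengths r_1, ..., r_n are indexed from 0: rho k is r_{k+1}, so the range
   i + 1 <= k <= j becomes i <= k < j. An empty big maximum is 0; for r < 0
   there are no simplices. *)
Definition is_nmax_simplex n (x : 'I_n.+1 -> X) : Prop :=
  exists rho : 'I_n -> \bar R,
    [/\ forall k, 0 <= rho k,
        \big[maxe/0]_(k < n) rho k <= r &
        forall i j : 'I_n.+1, (i <= j)%N ->
          dist (x i) (x j) <= \big[maxe/0]_(k < n | (i <= k < j)%N) rho k].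

Lemma dist_refl (a : X) : dist a a = 0.
Proof. exact/dist_eq0. Qed.

Lemma is_nmax_simplexP n (x : 'I_n.+1 -> X) :
  is_nmax_simplex x <->
  0 <= r /\ forall i j : 'I_n.+1, (i <= j)%N -> dist (x i) (x j) <= r.
Proof.
split=> [[rho [rho0 rho_r x_rho]]|[r0 xr]].
  have r0 : 0 <= r.
    apply: le_trans rho_r.
    by elim/big_ind : _ => // u v u0 v0; rewrite le_max u0.
  split=> // i j le_ij; apply: le_trans (x_rho _ _ le_ij) _.
  elim/big_ind : _ => // [u v ur vr|k _]; first by rewrite ge_max ur.
  by apply: le_trans rho_r; rewrite (bigD1 k) //= le_max lexx.
exists (fun=> r); split=> //.
  by elim/big_ind : _ => // u v ur vr; rewrite ge_max ur.
move=> i j; rewrite leq_eqVlt => /orP[/eqP/val_inj <-|lt_ij].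
  rewrite dist_refl.
  by elim/big_ind : _ => // u v u0 v0; rewrite le_max u0.
have lt_in : (i < n)%N by rewrite (leq_trans lt_ij) // -ltnS.
rewrite (bigD1 (Ordinal lt_in)) /= ?leqnn // le_max.
by rewrite (xr _ _ (ltnW lt_ij)).
Qed.

Lemma is_nmax_simplex_act m n (f : simplex_map m n) (x : 'I_n.+1 -> X) :
  is_nmax_simplex x -> is_nmax_simplex (x \o f).
Proof.
move=> /is_nmax_simplexP[r0 xr]; apply/is_nmax_simplexP; split=> // i j le_ij.
exact/xr/smap_homo.
Qed.

Definition nmax_obj n : Type := {x : 'I_n.+1 -> X | is_nmax_simplex x}.

Definition nmax_act m n (f : simplex_map m n) (s : nmax_obj n) : nmax_obj m :=
  exist _ (sval s \o f) (is_nmax_simplex_act f (svalP s)).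

Lemma nmax_id n s : nmax_act (smap_id n) s = s.
Proof. by case: s => x hx; exact: eq_exist. Qed.

Lemma nmax_comp m n p (g : simplex_map n p) (f : simplex_map m n) s :
  nmax_act (smap_comp g f) s = nmax_act f (nmax_act g s).
Proof. exact: eq_exist. Qed.

Definition Nmax : simplicial_set :=
  @SimplicialSet nmax_obj nmax_act nmax_id nmax_comp.

Definition Nmax_bar : simplicial_abgroup := free_simplicial_abgroup Nmax.

End Nmax.

Definition persistent_homology (R : realType) (X : honest_metric_space R)
    (r : \bar R) (n : nat) : zmodType :=
  homology (moore_complex (Nmax_bar X r)) n.

(* Main.v *)
(* Balls of radius r in an ultrametric space are the classes of an equivalence
   relation; choosing a point c(C) in each class C, the map
   (x_0, ..., x_n) |-> (c([x_0]), x_0, ..., x_n) is an extra degeneracy. It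
   commutes with d_0 as well, because x_0 and x_1 lie in the same class. Hence
   it sends a cycle z of positive degree to a Moore chain with boundary z. *)
Require Import Defs.
From mathcomp Require Import all_boot all_order all_algebra.
From mathcomp Require Import boolp reals constructive_ereal.
Import Order.TTheory GRing.Theory Num.Theory.

Set Implicit Arguments.
Unset Strict Implicit.
Unset Printing Implicit Defensive.

Local Open Scope ring_scope.

Lemma homology_eq0 (C : chain_complex) (n : nat) :
  (forall z : C n, z \in @is_cycle C n -> exists y, chain_diff C n y = z) ->
  forall h : homology C n, h = 0.
Proof.
move=> exC; elim/quotW=> z.
have -> : 0 = \pi_(Quotient.quot (@is_boundary C n))%qT 0 :> homology C n.
  by rewrite !piE.
apply/eqP; rewrite -Quotient.idealrBE subr0.
by apply/asboolP; apply: exC; exact: valP.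
Qed.

Section ExtraDegeneracy.
Variables (A : simplicial_abgroup) (s : forall n, {additive A n -> A n.+1}).
Hypothesis face0_s : forall n x, face A ord0 (s n x) = x.
Hypothesis faceS_s : forall n (i : 'I_n.+2) x,
  face A (lift ord0 i) (s n.+1 x) = s n (face A i x).

(** A Moore cycle of positive degree is killed by every face: by [d_0] as a cycle, by the others as
    a Moore chain. So [faceS_s] puts its image under [s] in the Moore complex, and [face0_s] makes
    that image a filling. *)
Lemma moore_homology_eq0 n (h : homology (moore_complex A) n.+1) : h = 0.
Proof.
move: h; apply: homology_eq0 => z; rewrite unfold_in /= => /eqP/(congr1 val) /= z0.
have faces_z (i : 'I_n.+2) : face A i (val z) = 0.
  have [j ->|->] := unliftP ord0 i; last exact: z0.
  by have /forallP/(_ j)/eqP := valP z.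
have sz : s n.+1 (val z) \in @is_moore A n.+2.
  by apply/forallP => i; rewrite faceS_s faces_z raddf0.
by exists (exist _ (s n.+1 (val z)) sz); apply: val_inj; rewrite /= face0_s.
Qed.

End ExtraDegeneracy.

Section FreeExtraDegeneracy.
Variables (X : simplicial_set) (s : forall n, X n -> X n.+1).
Hypothesis act0_s : forall n (x : X n), sset_act (coface ord0) (s x) = x.
Hypothesis actS_s : forall n (i : 'I_n.+2) (x : X n.+1),
  sset_act (coface (lift ord0 i)) (s x) = s (sset_act (coface i) x).

(** The identities between maps of simplices pass to the free groups by functoriality of [fgmap]. *)
Lemma free_moore_homology_eq0 n
  (h : homology (moore_complex (free_simplicial_abgroup X)) n.+1) : h = 0.
Proof.
pose sbar m : {additive free_simplicial_abgroup X m ->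
    free_simplicial_abgroup X m.+1} :=
  fgmap (@s m : {classic X m} -> {classic X m.+1}).
apply: (@moore_homology_eq0 _ sbar) => m.
  move=> x; rewrite /face /= /free_act /= -fgmap_comp.
  have -> : sset_act (coface ord0) \o @s m = id :> (X m -> X m).
    by apply: funext => y; exact: act0_s.
  exact: fgmap_id.
move=> i x; rewrite /face /= /free_act /= -!fgmap_comp.
by congr (fgmap _ x); apply: funext => y; exact: actS_s.
Qed.

End FreeExtraDegeneracy.

Section Ultrametric.
Variables (R : realType) (X : honest_metric_space R).
Hypothesis X_ultra : ultrametric X.
Variable r : \bar R.
Hypothesis r_ge0 : (0 <= r)%E.

Lemma ultrametric_le (a b c : X) :
  (dist a b <= r -> dist b c <= r -> dist a c <= r)%E.
Proof. by move=> ab bc; apply: le_trans (X_ultra a b c) _; rewrite ge_max ab. Qed.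

Lemma ball_inhabited (a : X) :
  exists b : {classic X}, `[< (dist a (b : X) <= r)%E >].
Proof. by exists a; apply/asboolP; rewrite dist_refl. Qed.

(** [xchoose] gives equal values on extensionally equal predicates, so the center depends on the
    ball as a set and not on [a]. *)
Definition ball_center (a : X) : X := xchoose (ball_inhabited a).

Lemma dist_ball_center a : (dist a (ball_center a) <= r)%E.
Proof. exact/asboolP/(xchooseP (ball_inhabited a)). Qed.

Lemma eq_ball_center a b : (dist a b <= r)%E -> ball_center a = ball_center b.
Proof.
(* By the ultrametric inequality, the balls of radius [r] around [a] and [b] have the same
   points. *)
move=> ab; apply: (@eq_xchoose {classic X}) => c; apply/asboolP/asboolP; last exact: ultrametric_le.
by apply: ultrametric_le; rewrite dist_sym.
Qed.

Definition add_center n (x : 'I_n.+1 -> X) (i : 'I_n.+2) : X :=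
  oapp x (ball_center (x ord0)) (unlift ord0 i).

Lemma nmax_simplex_dist n (x : 'I_n.+1 -> X) :
  is_nmax_simplex r x -> forall i j, (dist (x i) (x j) <= r)%E.
Proof.
move=> /is_nmax_simplexP[_ xr] i j; have [/xr //|/ltnW/xr] := leqP i j.
by rewrite dist_sym.
Qed.

(** All vertices, the new one included, lie within [r] of [x ord0]; comparing any two of them
    through this point gives the bound. *)
Lemma add_center_simplex n (x : 'I_n.+1 -> X) :
  is_nmax_simplex r x -> is_nmax_simplex r (add_center x).
Proof.
move=> /nmax_simplex_dist xr; apply/is_nmax_simplexP; split=> // i j _.
have near0 k : (dist (x ord0) (add_center x k) <= r)%E.
  rewrite /add_center; case: unlift => [l|] /=; first exact: xr.
  exact: dist_ball_center.
by apply: (@ultrametric_le _ (x ord0)); rewrite // dist_sym.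
Qed.

Definition nmax_add_center n (s : Nmax X r n) : Nmax X r n.+1 :=
  exist _ _ (add_center_simplex (svalP s)).

Lemma nmax_add_center_face0 n (s : Nmax X r n) :
  sset_act (coface ord0) (nmax_add_center s) = s.
Proof.
case: s => x xr; apply: eq_exist; apply: funext => i /=.
by rewrite /add_center liftK.
Qed.

Lemma nmax_add_center_faceS n (i : 'I_n.+2) (s : Nmax X r n.+1) :
  sset_act (coface (lift ord0 i)) (nmax_add_center s) =
  nmax_add_center (sset_act (coface i) s).
Proof.
case: s => x xr; apply: eq_exist; apply: funext => j /=.
rewrite /add_center; have [k ->|->] := unliftP ord0 j.
  have -> : lift (lift ord0 i) (lift ord0 k) = lift ord0 (lift i k).
    (* This is the cosimplicial identity evaluated at the vertex [k]. *)
    by have := congr1 (fun f : simplex_map _ _ => f k) (coface0K i).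
  by rewrite !liftK.
have -> : lift (lift ord0 i) ord0 = ord0 by apply: val_inj.
(* The first vertex changes only for [i = ord0], where [x_1] replaces [x_0]; both lie in one ball,
   so the center stays the same. *)
by rewrite !unlift_none /=; apply: eq_ball_center; exact: nmax_simplex_dist.
Qed.

End Ultrametric.

Theorem proposition26 (R : realType) (X : honest_metric_space R)
    (X_ultra : ultrametric X)
    (r : \bar R) (r_ge0 : (0 <= r)%E) (n : nat) (n_ge1 : (1 <= n)%N) :
  forall h : persistent_homology X r n, h = 0%R.
Proof.
case: n n_ge1 => // n _.
apply: (@free_moore_homology_eq0 _ (nmax_add_center X_ultra r_ge0)) => m.
  exact: nmax_add_center_face0.
exact: nmax_add_center_faceS.
Qed.
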